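(* Let $A_4\subseteq M_4=M_4(\mathbb{C})$ be the four cycle algebra, i.e. the linear span of the matrix units $E_{11},E_{22},E_{33},E_{44},E_{13},E_{14},E_{23},E_{24}$. Let $u=\begin{bmatrix}0&1\\1&0\end{bmatrix}\in M_2$, and consider the dynamical system $(A_4,\mathbb{Z}/2\mathbb{Z},\mathrm{ad}(u\oplus u))$ in which the nontrivial element of $\mathbb{Z}/2\mathbb{Z}$ acts on $A_4$ by $a\mapsto (u\oplus u)a(u\oplus u)^*$. Let $p=I_4+E_{14}+E_{41}\in M_4$, let $S_p:M_4\to M_4$ be the Schur (entrywise) product by $p$, and define $j:A_4\to M_4\oplus M_4$ by $j(a)=a\oplus S_p(a)$. Then $(C^*(j(A_4)),j)$ is a C*-cover for $A_4$ that is not $\mathrm{ad}(u\oplus u)$-admissible.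
   Context: A C*-cover for an operator algebra $\mathcal{A}$ is a pair $(\mathcal{C},j)$ where $\mathcal{C}$ is a C*-algebra and $j:\mathcal{A}\to\mathcal{C}$ is a completely isometric homomorphism with $\mathcal{C}=C^*(j(\mathcal{A}))$. Given an action $\alpha$ of a group $G$ on $\mathcal{A}$ by completely isometric automorphisms (strongly continuous), the C*-cover $(\mathcal{C},j)$ is $\alpha$-admissible if there is a (strongly continuous) action $\tilde\alpha:G\to\mathrm{Aut}(\mathcal{C})$ by $*$-automorphisms with $\tilde\alpha_s\circ j=j\circ\alpha_s$ for all $s\in G$. Here $C^*(j(A_4))$ is the C*-subalgebra of $M_4\oplus M_4$ generated by $j(A_4)$. *)

(* Defs.v *)
From HB Require Import structures.
From mathcomp Require Import all_boot all_order all_algebra all_fingroup.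
From mathcomp Require Import all_classical all_reals.
From mathcomp Require Import complex.

Set Implicit Arguments.
Unset Strict Implicit.
Unset Printing Implicit Defensive.

Import Order.TTheory GRing.Theory Num.Theory.

Local Open Scope classical_set_scope.
Local Open Scope ring_scope.
Local Open Scope complex_scope.
Local Open Scope sesquilinear_scope.

(* The complex numbers are R[i]. All algebras below are concrete algebras of
   operators on some C^k, that is, sets of matrices in 'M[R[i]]_k = B(C^k).
   The direct sum M_k (+) M_l is the algebra of block diagonal matrices in
   'M_(k + l) = B(C^k (+) C^l). *)

Definition l2norm (R : realType) (n : nat) (x : 'cV[R[i]]_n) : R :=
  Num.sqrt (\sum_(i < n) Normc.normc (x i 0) ^+ 2).

Definition opnorm (R : realType) (m n : nat) (M : 'M[R[i]]_(m, n)) : R :=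
  sup [set l2norm (M *m x) | x in [set x : 'cV[R[i]]_n | l2norm x <= 1]].

Definition opnorm_closed (R : realType) (k : nat) (A : set 'M[R[i]]_k) : Prop :=
  forall x, (forall e : R, 0 < e -> exists2 y, A y & opnorm (x - y) < e) -> A x.

Definition operator_algebra (R : realType) (k : nat)
    (A : set 'M[R[i]]_k) : Prop :=
  [/\ A 0,
      forall (c : R[i]) x y, A x -> A y -> A (c *: x + y),
      forall x y, A x -> A y -> A (x *m y)
    & opnorm_closed A].

Definition cstar_algebra (R : realType) (k : nat)
    (C : set 'M[R[i]]_k) : Prop :=
  operator_algebra C /\ forall x, C x -> C (x ^t*).

Definition cstar_generated (R : realType) (k : nat)
    (S : set 'M[R[i]]_k) : set 'M[R[i]]_k :=
  smallest (@cstar_algebra R k) S.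

(* Maps between algebras are total functions between the ambient matrix
   algebras; only their values on the given algebra matter. *)

Definition homomorphism_on (R : realType) (k l : nat) (A : set 'M[R[i]]_k)
    (f : 'M[R[i]]_k -> 'M[R[i]]_l) : Prop :=
  (forall (c : R[i]) x y, A x -> A y -> f (c *: x + y) = c *: f x + f y) /\
  (forall x y, A x -> A y -> f (x *m y) = f x *m f y).

(* M_n(A) is normed as a space of operators on C^n (x) C^k: an n x n array of
   k x k matrices is read as one block matrix. *)
Definition completely_isometric_on (R : realType) (k l : nat)
    (A : set 'M[R[i]]_k) (f : 'M[R[i]]_k -> 'M[R[i]]_l) : Prop :=
  forall (n : nat) (X : 'I_n -> 'I_n -> 'M[R[i]]_k),
    (forall i j, A (X i j)) ->
    opnorm (\mxblock_(i < n, j < n) f (X i j)) =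
    opnorm (\mxblock_(i < n, j < n) X i j).

Definition cstar_cover (R : realType) (k l : nat) (A : set 'M[R[i]]_k)
    (C : set 'M[R[i]]_l) (j : 'M[R[i]]_k -> 'M[R[i]]_l) : Prop :=
  [/\ cstar_algebra C,
      homomorphism_on A j,
      completely_isometric_on A j
    & C = cstar_generated (j @` A)].

Definition action_on (G : finGroupType) (T : Type) (A : set T)
    (alpha : G -> T -> T) : Prop :=
  (forall a, A a -> alpha 1%g a = a) /\
  (forall s t a, A a -> alpha (s * t)%g a = alpha s (alpha t a)).

(* Finite groups are discrete, so strong continuity of actions is automatic. *)
Definition dynamical_system (R : realType) (k : nat) (A : set 'M[R[i]]_k)
    (G : finGroupType) (alpha : G -> 'M[R[i]]_k -> 'M[R[i]]_k) : Prop :=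
  [/\ operator_algebra A,
      action_on A alpha
    & forall s, [/\ set_bij A A (alpha s), homomorphism_on A (alpha s)
                  & completely_isometric_on A (alpha s)]].

Definition star_automorphism (R : realType) (k : nat) (C : set 'M[R[i]]_k)
    (f : 'M[R[i]]_k -> 'M[R[i]]_k) : Prop :=
  [/\ set_bij C C f, homomorphism_on C f
    & forall x, C x -> f (x ^t*) = (f x) ^t*].

Definition admissible (R : realType) (k l : nat) (A : set 'M[R[i]]_k)
    (G : finGroupType) (alpha : G -> 'M[R[i]]_k -> 'M[R[i]]_k)
    (C : set 'M[R[i]]_l) (j : 'M[R[i]]_k -> 'M[R[i]]_l) : Prop :=
  exists beta : G -> 'M[R[i]]_l -> 'M[R[i]]_l,
    [/\ action_on C beta,
        forall s, star_automorphism C (beta s)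
      & forall s a, A a -> beta s (j a) = j (alpha s a)].

(* The matrix unit E_{ij}, for 1 <= i, j <= 4. *)
Definition E4 (R : realType) (i j : nat) : 'M[R[i]]_4 :=
  delta_mx (inord i.-1) (inord j.-1).

Definition four_cycle_algebra (R : realType) : set 'M[R[i]]_4 :=
  [set a | a \in <<[:: E4 R 1 1; E4 R 2 2; E4 R 3 3; E4 R 4 4;
                       E4 R 1 3; E4 R 1 4; E4 R 2 3; E4 R 2 4]>>%VS].

Definition flip2 (R : realType) : 'M[R[i]]_2 :=
  \matrix_(i < 2, j < 2) (i != j)%:R.

Definition dsum (R : realType) (k l : nat) (a : 'M[R[i]]_k) (b : 'M[R[i]]_l) :
    'M[R[i]]_(k + l) :=
  block_mx a 0 0 b.

Definition ad (R : realType) (k : nat) (w a : 'M[R[i]]_k) : 'M[R[i]]_k :=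
  w *m a *m w ^t*.

(* The action of Z/2 whose nontrivial element acts as ad (u (+) u); 1%g is the
   neutral element of the group 'Z_2. *)
Definition flip_action (R : realType) (s : 'Z_2) (a : 'M[R[i]]_4) :
    'M[R[i]]_4 :=
  if s == 1%g then a else ad (dsum (flip2 R) (flip2 R)) a.

Definition schur_mult (R : realType) (k : nat) (p a : 'M[R[i]]_k) :
    'M[R[i]]_k :=
  map2_mx *%R p a.

Definition pmat (R : realType) : 'M[R[i]]_4 := 1%:M + E4 R 1 4 + E4 R 4 1.

Definition jmap (R : realType) (a : 'M[R[i]]_4) : 'M[R[i]]_(4 + 4) :=
  dsum a (schur_mult (pmat R) a).

(* Main.v *)
Require Import Defs.
From HB Require Import structures.
From mathcomp Require Import all_boot all_order all_algebra all_fingroup.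
From mathcomp Require Import all_classical all_reals.
From mathcomp Require Import complex.

Set Implicit Arguments.
Unset Strict Implicit.
Unset Printing Implicit Defensive.

Import Order.TTheory GRing.Theory Num.Theory Normc.

Local Open Scope classical_set_scope.
Local Open Scope ring_scope.
Local Open Scope sesquilinear_scope.

(** The four cycle algebra consists of the matrices vanishing off an explicit
    set of positions ([four_cycle_algebraP]), so it is closed, and it is an
    algebra because two consecutive off-diagonal positions never occur
    ([edge4_trans]).

    Both complete isometry claims rest on one estimate,
    [opnorm_mxblock_pinching]: relabelling the rows and columns of every block
    along [f] and keeping only the entries whose row and column lie in the same
    class of a partition, with [f] injective on each class, does not increase
    the norm of a block matrix. Conjugation by [u (+) u] is such a relabelling by
    an involution, so the estimate applies in both directions. The Schur product
    by [p] is the pinching for the partition {1,4}, {2}, {3} of the indices,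
    hence [a (+) S_p a] is obtained from [a] by folding the eight indices onto
    four and pinching; conversely [a] is a corner of [a (+) S_p a].
    Multiplicativity of [S_p] on the algebra holds because in each product of
    two entries one factor is diagonal, and [p] is 1 on the diagonal.

    The cover is not admissible because [S_p] keeps E_14 but kills its image
    E_23 under the flip. In the C*-algebra, [j E_14 (j E_14)^* = j E_11]. An
    extension of the flip to a *-homomorphism sends the right side to
    [j E_22 = E_22 (+) E_22] and the left side to
    [j E_23 (j E_23)^* = E_22 (+) 0]. *)

(** * The operator norm *)

Lemma normc_ge0 (R : realType) (z : R[i]) : 0 <= normc z.
Proof. by case: z => a b; rewrite /normc sqrtr_ge0. Qed.

Lemma normc_sum_le (R : realType) (I : finType) (F : I -> R[i]) :
  normc (\sum_i F i) <= \sum_i normc (F i).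
Proof.
elim/big_ind2: _ => [|a z b w za wb|//]; first by rewrite normc0.
have zwD : normc (z + w) <= normc z + normc w := le_normcD z w.
by apply: le_trans zwD _; exact: lerD za wb.
Qed.

Definition sqnorm (R : realType) (I : finType) (v : I -> R[i]) : R :=
  \sum_i normc (v i) ^+ 2.

Lemma sqnorm_ge0 (R : realType) (I : finType) (v : I -> R[i]) : 0 <= sqnorm v.
Proof. by apply: sumr_ge0 => i _; exact: sqr_ge0. Qed.

(** Operators are given by kernels on arbitrary finite index sets, so that
    block matrices and matrices with relabelled indices need no casts. *)
Definition bounded_by (R : realType) (I J : finType) (K : I -> J -> R[i])
    (B : R) : Prop :=
  forall v : J -> R[i],
    sqnorm (fun i => \sum_j K i j * v j) <= B ^+ 2 * sqnorm v.

Section OperatorNorm.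
Variables (R : realType) (m n : nat).
Implicit Types (M : 'M[R[i]]_(m, n)) (x : 'cV[R[i]]_n).

Lemma l2normE k (x : 'cV[R[i]]_k) : l2norm x = Num.sqrt (sqnorm (x^~ 0)).
Proof. by []. Qed.

Lemma l2norm_ge0 k (x : 'cV[R[i]]_k) : 0 <= l2norm x.
Proof. exact: sqrtr_ge0. Qed.

Lemma l2normZ k (c : R[i]) (x : 'cV[R[i]]_k) :
  l2norm (c *: x) = normc c * l2norm x.
Proof.
rewrite !l2normE -[normc c]ger0_norm ?normc_ge0// -sqrtr_sqr.
rewrite -sqrtrM ?sqr_ge0// /sqnorm mulr_sumr; congr Num.sqrt.
by apply: eq_bigr => i _; rewrite mxE normcM exprMn.
Qed.

Lemma normc_le_l2norm k (x : 'cV[R[i]]_k) i : normc (x i 0) <= l2norm x.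
Proof.
rewrite l2normE -[normc _]ger0_norm ?normc_ge0// -sqrtr_sqr ler_sqrt ?sqnorm_ge0//.
by rewrite /sqnorm (bigD1 i)//= lerDl sumr_ge0// => j _; exact: sqr_ge0.
Qed.

Lemma l2norm_eq0 k (x : 'cV[R[i]]_k) : l2norm x = 0 -> x = 0.
Proof.
move=> x0; apply/matrixP => i j; rewrite ord1 mxE; apply: eq0_normc.
by apply/eqP; rewrite eq_le normc_ge0 andbT -x0 normc_le_l2norm.
Qed.

(** Without this bound the supremum defining the operator norm would be the
    default value 0. *)
Lemma opnorm_has_ubound M :
  has_ubound [set l2norm (M *m x) | x in [set x : 'cV[R[i]]_n | l2norm x <= 1]].
Proof.
exists (Num.sqrt (\sum_i (\sum_j normc (M i j)) ^+ 2)) => _ [x /= x1 <-].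
rewrite ler_sqrt ?sumr_ge0// => [|i _]; last exact: sqr_ge0.
apply: ler_sum => i _; rewrite lerXn2r ?nnegrE ?normc_ge0 ?sumr_ge0// => [j _|].
  exact: normc_ge0.
rewrite mxE; apply: le_trans (normc_sum_le _) _; apply: ler_sum => j _.
rewrite normcM ler_piMr ?normc_ge0//.
exact: le_trans (normc_le_l2norm x j) x1.
Qed.

Lemma opnorm_ge0 M : 0 <= opnorm M.
Proof.
apply: ub_le_sup; first exact: opnorm_has_ubound.
have l20 k : l2norm (0 : 'cV[R[i]]_k) = 0.
  by rewrite -(scale0r 0) l2normZ normc0 mul0r.
by exists 0; rewrite /= ?mulmx0 l20.
Qed.

Lemma l2norm_mulmx M x : l2norm (M *m x) <= opnorm M * l2norm x.
Proof.
have [x0|x0] := eqVneq (l2norm x) 0.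
  rewrite x0 mulr0 (l2norm_eq0 x0) mulmx0 -(scale0r 0) l2normZ normc0.
  by rewrite mul0r.
have xgt0 : 0 < l2norm x by rewrite lt_def x0 l2norm_ge0.
pose c : R[i] := Complex (l2norm x)^-1 0.
have cE : normc c = (l2norm x)^-1.
  rewrite /c /normc expr0n/= addr0 sqrtr_sqr ger0_norm// invr_ge0.
  exact: l2norm_ge0.
rewrite -ler_pdivrMr// mulrC -cE -l2normZ scalemxAr.
apply: ub_le_sup; first exact: opnorm_has_ubound.
by exists (c *: x) => //=; rewrite l2normZ cE mulVf.
Qed.

Lemma opnorm_leP M (B : R) : 0 <= B -> (opnorm M <= B) <-> bounded_by M B.
Proof.
move=> B0; split=> [MB v|MB].
  pose x : 'cV[R[i]]_n := \col_j v j.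
  have -> : sqnorm v = sqnorm (x^~ 0).
    by apply: eq_bigr => j _; rewrite mxE.
  have -> : sqnorm (fun i => \sum_j M i j * v j) = sqnorm ((M *m x)^~ 0).
    apply: eq_bigr => i _; rewrite mxE; congr (normc _ ^+ 2).
    by apply: eq_bigr => j _; rewrite mxE.
  rewrite -[X in X <= _]sqr_sqrtr ?sqnorm_ge0//.
  rewrite -[X in _ <= _ * X]sqr_sqrtr ?sqnorm_ge0// -!l2normE -exprMn.
  rewrite lerXn2r ?nnegrE ?mulr_ge0 ?l2norm_ge0//.
  by apply: le_trans (l2norm_mulmx M x) _; rewrite ler_wpM2r ?l2norm_ge0.
apply: ge_sup.
  exists (l2norm (M *m 0)), 0 => //=.
  by rewrite -(scale0r 0) l2normZ normc0 mul0r.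
move=> _ [x /= x1 <-]; apply: (@le_trans _ _ (B * l2norm x)); last first.
  by rewrite ler_piMr.
rewrite !l2normE -[B]ger0_norm// -sqrtr_sqr -sqrtrM ?sqr_ge0//.
rewrite ler_sqrt ?mulr_ge0 ?sqr_ge0 ?sqnorm_ge0//.
apply: le_trans (MB (x^~ 0)); rewrite le_eqVlt; apply/orP; left; apply/eqP.
by apply: eq_bigr => i _; rewrite mxE.
Qed.

End OperatorNorm.

(** An entry is a coordinate of the image of a basis vector. This makes sets of
    matrices defined by vanishing entries norm closed. *)
Lemma normc_le_opnorm (R : realType) m n (M : 'M[R[i]]_(m, n)) i j :
  normc (M i j) <= opnorm M.
Proof.
have -> : M i j = (M *m delta_mx j 0 : 'cV_m) i 0.
  by rewrite -colE mxE.
apply: le_trans (normc_le_l2norm _ _) _; apply: le_trans (l2norm_mulmx _ _) _.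
rewrite ler_piMr ?opnorm_ge0// l2normE /sqnorm (bigD1 j)//= big1 => [|k kj].
  by rewrite mxE !eqxx normc1 expr1n addr0 sqrtr1.
by rewrite mxE (negPf kj) normc0 expr0n.
Qed.

(** * Pinching a block matrix *)

Lemma sum_at_most_one (R : nmodType) (S : nmodType) (I : finType) (P : pred I)
    (F : I -> R) (h : R -> S) :
  h 0 = 0 -> (forall i j, P i -> P j -> i = j) ->
  h (\sum_(i | P i) F i) = \sum_(i | P i) h (F i).
Proof.
move=> h0 P1; case: (pickP P) => [i Pi|P0]; last by rewrite !big_pred0.
have PE : P =1 pred1 i.
  by move=> j; apply/idP/eqP => [Pj|->//]; exact: P1.
by rewrite !(big_pred1 i).
Qed.

(** Split the input [v] into its parts supported on the classes of [b]. The new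
    operator maps the part of class [t] to coordinates of class [t] only, where
    it acts as [K] on the vector [w t], the transport of that part along [f].
    So the squared norms of the outputs are bounded class by class, and they add
    up because [v] is the orthogonal sum of its parts. *)
Lemma bounded_by_pinching (R : realType) (I J T : finType)
    (K : I -> I -> R[i]) (f : J -> I) (b : J -> T) (B : R) :
  (forall j j', b j = b j' -> f j = f j' -> j = j') ->
  bounded_by K B ->
  bounded_by (fun j j' => if b j == b j' then K (f j) (f j') else 0) B.
Proof.
move=> fb KB v.
(* Since f is injective on classes, this sum has at most one term. *)
pose w t i := \sum_(j | (b j == t) && (f j == i)) v j.
have one t i j j' : (b j == t) && (f j == i) -> (b j' == t) && (f j' == i) ->
    j = j'.
  by move=> /andP[/eqP bj /eqP fj] /andP[/eqP bj' /eqP fj'];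
     apply: fb; rewrite ?bj ?fj.
have -> : sqnorm v = \sum_t sqnorm (w t).
  rewrite /sqnorm (partition_big b predT)//=; apply: eq_bigr => t _.
  rewrite (partition_big f predT)//=; apply: eq_bigr => i _.
  rewrite (@sum_at_most_one _ _ _ _ _ (fun z : R[i] => normc z ^+ 2))//.
    by rewrite normc0 expr0n.
  exact: one.
rewrite mulr_sumr {1}/sqnorm (partition_big b predT)//=.
apply: ler_sum => t _; apply: le_trans (KB (w t)).
rewrite /sqnorm (partition_big f predT)//=; apply: ler_sum => i _.
set z := normc (\sum_i' K i i' * w t i') ^+ 2.
have -> : \sum_(j | (b j == t) && (f j == i))
    normc (\sum_j' (if b j == b j' then K (f j) (f j') else 0) * v j') ^+ 2
    = \sum_(j | (b j == t) && (f j == i)) z.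
  apply: eq_bigr => j /andP[/eqP bj /eqP fj]; rewrite /z /w -bj -fj; congr (normc _ ^+ 2).
  under [RHS]eq_bigr do rewrite mulr_sumr.
  rewrite (eq_bigr (fun j' => if b j' == b j then K (f j) (f j') * v j' else 0)).
    rewrite -big_mkcond (partition_big f predT)//=; apply: eq_bigr => i' _.
    by apply: eq_bigr => j' /andP[_ /eqP <-].
  by move=> j' _; rewrite eq_sym; case: ifP; rewrite ?mul0r.
have z0 : 0 <= z by exact: sqr_ge0.
case: (pickP (fun j => (b j == t) && (f j == i))) => [j0 Pj0|P0].
  rewrite (big_pred1 j0)// => j; apply/idP/eqP => [|->//] Pj.
  exact: one Pj Pj0.
by rewrite big_pred0.
Qed.

(** Positions of a block matrix are numbered by [tagnat.rank] from pairs of a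
    block index and an index inside the block. *)
Lemma mxblock_tagnatE (R : nzRingType) n k
    (X : 'I_n -> 'I_n -> 'M[R]_k) (x y : {i : 'I_n & 'I_k}) :
  (\mxblock_(i < n, j < n) X i j)
    (tagnat.rank x : 'I_(\sum_(i < n) k)%N) (tagnat.rank y) =
  X (tag x) (tag y) (tagged x) (tagged y).
Proof. by rewrite mxE /tagnat.sig1 /tagnat.sig2 !tagnat.rankK. Qed.

(** The pinching estimate for all matrix amplifications at once: the indices of
    the blocks are left alone, while the indices inside are mapped by [f] and
    classified by [b]. *)
Lemma opnorm_mxblock_pinching (R : realType) (n k l : nat) (T : finType)
    (X : 'I_n -> 'I_n -> 'M[R[i]]_k) (Y : 'I_n -> 'I_n -> 'M[R[i]]_l)
    (f : 'I_l -> 'I_k) (b : 'I_l -> T) :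
  (forall a c, b a = b c -> f a = f c -> a = c) ->
  (forall i j a c, Y i j a c = if b a == b c then X i j (f a) (f c) else 0) ->
  opnorm (\mxblock_(i < n, j < n) Y i j) <=
  opnorm (\mxblock_(i < n, j < n) X i j).
Proof.
move=> fb YE; set N := opnorm (\mxblock_(i, j) X i j).
apply/(opnorm_leP _ (opnorm_ge0 _)).
have KN : bounded_by (\mxblock_(i, j) X i j) N.
  exact: (opnorm_leP _ (opnorm_ge0 _)).1 (lexx _).
pose F (s : 'I_(\sum_(i < n) l)) : 'I_(\sum_(i < n) k) :=
  tagnat.rank (Tagged (fun=> 'I_k) (i := tagnat.sig1 s) (f (tagnat.sig2 s))).
have Finj s s' : b (tagnat.sig2 s) = b (tagnat.sig2 s') -> F s = F s' -> s = s'.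
  move=> bs /(can_inj tagnat.rankK) Fs.
  have {Fs} [ts fs] := (congr1 tag Fs, congr1 (fun x => tagged x : 'I_k) Fs).
  apply: tagnat.sig_inj; move: bs ts fs.
  rewrite /tagnat.sig2 /tagnat.sig1.
  case: (tagnat.sig s) => i a; case: (tagnat.sig s') => j c /= bac -> fac.
  by rewrite (fb _ _ bac fac).
move=> v; have := bounded_by_pinching Finj KN v.
congr (_ <= _); apply: eq_bigr => s _; congr (normc _ ^+ 2).
apply: eq_bigr => s' _; congr (_ * _).
by rewrite mxblock_tagnatE mxE YE.
Qed.

(** * The four cycle algebra *)

(** The positions of the four cycle algebra, with indices counted from 0. *)
Definition edge4 (i j : 'I_4) : bool := (i == j) || ((i < 2) && (1 < j))%N.

Lemma edge4_trans i j k : edge4 i j -> edge4 j k -> (i == j) || (j == k).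
Proof.
rewrite /edge4; case: eqP => //= _; case: eqP => //= _ /andP[_ j1] /andP[j2 _].
by have := leq_trans j2 j1; rewrite ltnn.
Qed.

Section FourCycle.
Variable R : realType.
Local Notation A4 := (@four_cycle_algebra R).
Implicit Types a b : 'M[R[i]]_4.

Lemma four_cycle_algebraP a :
  A4 a <-> forall i j, ~~ edge4 i j -> a i j = 0.
Proof.
rewrite /four_cycle_algebra /=; split=> [|aE].
  set X := (X in span X) => /(@coord_span _ _ _ (in_tuple X)) -> i j ij.
  rewrite summxE big1 // => r _; rewrite mxE.
  suff -> : X`_r i j = 0 by rewrite mulr0.
  have : X`_r \in X by exact: mem_nth.
  have dE (p q : nat) : (p < 4)%N -> (q < 4)%N ->
      edge4 (inord p) (inord q) -> (E4 R p.+1 q.+1) i j = 0.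
    move=> p4 q4 pq; rewrite mxE; case: eqP => //= ip; case: eqP => //= jq.
    by rewrite ip jq pq in ij.
  rewrite !inE => /or4P[/eqP->|/eqP->|/eqP->|].
  1-3: by apply: dE; rewrite // /edge4 eqxx.
  by case/or4P=> [/eqP->|/eqP->|/eqP->|/orP[]/eqP->];
     apply: dE; rewrite // /edge4 ?eqxx // ?inordK // orbT.
rewrite [a]matrix_sum_delta; apply: memv_suml => i _; apply: memv_suml => j _.
have [ij|/aE ->] := boolP (edge4 i j); last by rewrite scale0r mem0v.
apply: memvZ; apply: memv_span.
have EE p q : delta_mx (inord p) (inord q) = E4 R p.+1 q.+1 by [].
rewrite -(inord_val i) -(inord_val j) EE.
by case: i j ij => [[|[|[|[|//]]]] ?] [[|[|[|[|//]]]] ?];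
   rewrite /edge4 //= => _; rewrite !inE eqxx ?orbT.
Qed.

Lemma four_cycle_operator_algebra : operator_algebra A4.
Proof.
split=> [|c x y /four_cycle_algebraP xA /four_cycle_algebraP yA|
  x y /four_cycle_algebraP xA /four_cycle_algebraP yA|x xcl];
  apply/four_cycle_algebraP => i j ij.
- by rewrite mxE.
- by rewrite !mxE xA // yA // mulr0 addr0.
- rewrite mxE big1 // => k _.
  have [ik|/xA ->] := boolP (edge4 i k); last by rewrite mul0r.
  have [kj|/yA ->] := boolP (edge4 k j); last by rewrite mulr0.
  by case/orP: (edge4_trans ik kj) => /eqP e; move: ij; rewrite ?e ?kj// -e ik.
- apply: eq0_normc; apply/eqP; rewrite eq_le normc_ge0 andbT.
  apply/ler_addgt0Pr => e e0; rewrite add0r.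
  have [y /four_cycle_algebraP yA xy] := xcl e e0.
  apply: le_trans (ltW xy); have -> : x i j = (x - y) i j.
    by rewrite !mxE yA // subr0.
  exact: normc_le_opnorm.
Qed.

(** * The flip action *)

(** The permutation of indices underlying [u (+) u]: it exchanges the two
    indices within each summand of 2 + 2. *)
Definition swap4 (i : 'I_4) : 'I_4 :=
  unsplit (match fintype.split (i : 'I_(2 + 2)) with
           | inl a => inl (rev_ord a) | inr a => inr (rev_ord a) end).

Lemma swap4K : involutive swap4.
Proof.
move=> i; rewrite /swap4 unsplitK -[RHS](@splitK 2 2 i).
by case: (fintype.split _) => a; rewrite rev_ordK.
Qed.

Lemma val_swap4 i : swap4 i = nth 0%N [:: 1; 0; 3; 2]%N i :> nat.
Proof.
rewrite /swap4; case: splitP => k /= ->.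
  by case: k => [[|[|//]] ?].
by case: k => [[|[|//]] ?].
Qed.

Lemma edge4_swap i j : edge4 (swap4 i) (swap4 j) = edge4 i j.
Proof.
rewrite /edge4 (inj_eq (can_inj swap4K)); congr (_ || _).
rewrite !val_swap4; by case: i j => [[|[|[|[|//]]]] ?] [[|[|[|[|//]]]] ?].
Qed.

Local Notation w := (dsum (flip2 R) (flip2 R)).

Lemma flipE i j : w i j = (swap4 i == j)%:R.
Proof.
rewrite /dsum /swap4.
rewrite -[in LHS](@splitK 2 2 i) -[in LHS](@splitK 2 2 j) -[j in RHS](@splitK 2 2 j).
have rev2 (p q : 'I_2) : (p != q) = (rev_ord p == q).
  by case: p q => [[|[|//]] ?] [[|[|//]] ?].
have us (x y : 'I_2 + 'I_2) : (unsplit x == unsplit y :> 'I_4) = (x == y).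
  exact: (inj_eq (can_inj unsplitK)).
rewrite us.
case: (fintype.split i) => p; case: (fintype.split j) => q /=.
- by rewrite block_mxEul mxE rev2.
- by rewrite block_mxEur mxE.
- by rewrite block_mxEdl mxE.
- by rewrite block_mxEdr mxE rev2.
Qed.

Lemma ad_relabel k (v a : 'M[R[i]]_k) (s : 'I_k -> 'I_k) :
  (forall i j, v i j = (s i == j)%:R) ->
  forall i j, ad v a i j = a (s i) (s j).
Proof.
move=> vE i j; rewrite mxE (bigD1 (s j)) //= big1 ?addr0 => [|l lj]; last first.
  by rewrite !mxE vE eq_sym (negPf lj) conjC0 mulr0.
rewrite !mxE vE eqxx conjC1 mulr1 (bigD1 (s i)) //= big1 ?addr0.
  by rewrite vE eqxx mul1r.
by move=> l li; rewrite vE eq_sym (negPf li) mul0r.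
Qed.

Lemma ad_flipE a i j : ad w a i j = a (swap4 i) (swap4 j).
Proof. exact: ad_relabel flipE _ _. Qed.

Lemma ad_flipK : involutive (ad w).
Proof. by move=> a; apply/matrixP => i j; rewrite !ad_flipE !swap4K. Qed.

Lemma ad_flip_A4 a : A4 a -> A4 (ad w a).
Proof.
move=> /four_cycle_algebraP aA; apply/four_cycle_algebraP => i j ij.
by rewrite ad_flipE aA // edge4_swap.
Qed.

Lemma ad_flip_homomorphism : homomorphism_on A4 (ad w).
Proof.
split=> [c x y _ _|x y _ _]; apply/matrixP => i j.
  by rewrite [RHS]mxE [X in _ = X + _]mxE !ad_flipE !mxE.
rewrite ad_flipE [LHS]mxE [RHS]mxE (reindex_inj (can_inj swap4K)).
by apply: eq_bigr => k _; rewrite !ad_flipE.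
Qed.

(** The flip is a relabelling of indices with trivial partition, and so is its
    inverse; the pinching estimate gives both inequalities. *)
Lemma ad_flip_completely_isometric : completely_isometric_on A4 (ad w).
Proof.
move=> n X _; apply/le_anti/andP; split.
- apply: (@opnorm_mxblock_pinching _ _ _ _ unit _ _ swap4 (fun=> tt)).
    by move=> a c _ /(can_inj swap4K).
  by move=> i j a c; rewrite eqxx ad_flipE.
- apply: (@opnorm_mxblock_pinching _ _ _ _ unit _ _ swap4 (fun=> tt)).
    by move=> a c _ /(can_inj swap4K).
  by move=> i j a c; rewrite eqxx ad_flipE !swap4K.
Qed.

Lemma flip_dynamical_system : dynamical_system A4 (@flip_action R).
Proof.
split; first exact: four_cycle_operator_algebra.
  split=> [a _|s t a _]; first by rewrite /flip_action eqxx.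
  rewrite /flip_action.
  have [->|s1] := eqVneq s 1%g; first by rewrite mul1g.
  have [->|t1] := eqVneq t 1%g; first by rewrite mulg1 (negPf s1).
  suff -> : (s * t)%g = 1%g by rewrite eqxx ad_flipK.
  by apply/val_inj; case: s t s1 t1 => [[|[|//]] ?] [[|[|//]] ?].
move=> s; rewrite /flip_action; case: eqP => _.
  split=> //; split=> //= a aA.
  by exists a.
split; [|exact: ad_flip_homomorphism|exact: ad_flip_completely_isometric].
split=> [a|a b _ _|a aA] /=; first exact: ad_flip_A4.
  exact: (can_inj ad_flipK).
by exists (ad w a); [exact: ad_flip_A4|exact: ad_flipK].
Qed.

(** * The map j *)

(** The classes of the partition {1,4}, {2}, {3}; the last index stands for 4
    and joins the class of the first one. *)
Definition schur_block (i : 'I_4) : 'I_4 := if i == ord_max then ord0 else i.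

Lemma pmatE i j : pmat R i j = (schur_block i == schur_block j)%:R.
Proof.
rewrite !mxE /schur_block -!val_eqE /= !inordK //.
by case: i j => [[|[|[|[|//]]]] ?] [[|[|[|[|//]]]] ?];
   rewrite /= ?addr0 ?add0r.
Qed.

Local Notation Sp := (schur_mult (pmat R)).

Lemma schurE a i j :
  Sp a i j = if schur_block i == schur_block j then a i j else 0.
Proof. by rewrite mxE pmatE; case: eqP; rewrite ?mul1r ?mul0r. Qed.

(** In a nonzero term [x i k * y k j] one has [i = k] or [k = j], so that
    [p i k * p k j = p i j]. *)
Lemma schur_homomorphism : homomorphism_on A4 Sp.
Proof.
split=> [c x y _ _|x y /four_cycle_algebraP xA /four_cycle_algebraP yA];
  apply/matrixP => i j.
  by rewrite !mxE mulrDr mulrCA.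
rewrite [LHS]mxE [X in _ * X]mxE [RHS]mxE mulr_sumr; apply: eq_bigr => k _.
rewrite !schurE pmatE.
have [ik|/xA xik] := boolP (edge4 i k); last first.
  by rewrite xik !if_same !(mulr0, mul0r).
have [kj|/yA ykj] := boolP (edge4 k j); last first.
  by rewrite ykj !if_same !mulr0.
case/orP: (edge4_trans ik kj) => /eqP e; rewrite e eqxx;
  by case: eqP; rewrite ?mul1r ?mul0r ?mulr0.
Qed.

Lemma jmap_homomorphism : homomorphism_on A4 (@jmap R).
Proof.
have [SpD SpM] := schur_homomorphism.
split=> [c x y xA yA|x y xA yA]; rewrite /jmap /dsum.
  by rewrite SpD // scale_block_mx add_block_mx !scaler0 !addr0.
by rewrite SpM // mulmx_block !(mulmx0, mul0mx, addr0, add0r).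
Qed.

(** For the upper bound the eight indices are folded onto four by [f]. The
    partition [b] puts the first summand in one class and splits the second
    summand according to the Schur multiplier; [f] is injective on each class.
    For the lower bound, the first summand of [j a] is [a] itself. *)
Lemma jmap_completely_isometric : completely_isometric_on A4 (@jmap R).
Proof.
move=> n X _; apply/le_anti/andP; split.
- pose f (p : 'I_(4 + 4)) : 'I_4 := match fintype.split p with inl a | inr a => a end.
  pose b (p : 'I_(4 + 4)) : option 'I_4 :=
    match fintype.split p with inl _ => None | inr a => Some (schur_block a) end.
  apply: (@opnorm_mxblock_pinching _ _ _ _ _ _ _ f b) => [p q|i j p q].
    rewrite /f /b -{3}(splitK p) -{3}(splitK q).
    by case: (fintype.split p) => a; case: (fintype.split q) => c //= _ ->.
  rewrite /f /b /jmap /dsum -{1}(splitK p) -{1}(splitK q).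
  case: (fintype.split p) => a; case: (fintype.split q) => c /=.
  + by rewrite block_mxEul.
  + by rewrite block_mxEur mxE.
  + by rewrite block_mxEdl mxE.
  + by rewrite block_mxEdr schurE.
- apply: (@opnorm_mxblock_pinching _ _ _ _ unit _ _ (lshift 4) (fun=> tt)).
    by move=> a c _ /lshift_inj.
  by move=> i j a c; rewrite eqxx /jmap /dsum block_mxEul.
Qed.

End FourCycle.

(** * Generated C*-algebras and non-admissibility *)

Lemma cstar_generated_cstar (R : realType) k (S : set 'M[R[i]]_k) :
  cstar_algebra (cstar_generated S).
Proof.
split; first split.
- by move=> B [[[B0 _ _ _] _] _].
- move=> c x y Cx Cy B BS; have [[[_ BD _ _] _] _] := BS.
  by apply: BD; [exact: Cx|exact: Cy].
- move=> x y Cx Cy B BS; have [[[_ _ BM _] _] _] := BS.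
  by apply: BM; [exact: Cx|exact: Cy].
- move=> x xcl B BS; have [[[_ _ _ Bcl] _] _] := BS.
  apply: Bcl => e /xcl[y Cy xy]; exists y => //; exact: Cy.
- move=> x Cx B BS; have [[_ Bs] _] := BS.
  by apply: Bs; exact: Cx.
Qed.

Lemma dsum_mul (R : realType) k l (a b : 'M[R[i]]_k) (c d : 'M[R[i]]_l) :
  dsum a c *m dsum b d = dsum (a *m b) (c *m d).
Proof. by rewrite mulmx_block !(mulmx0, mul0mx, addr0, add0r). Qed.

Lemma dsum_adj (R : realType) k l (a : 'M[R[i]]_k) (b : 'M[R[i]]_l) :
  (dsum a b)^t* = dsum (a^t*) (b^t*).
Proof. by rewrite /dsum tr_block_mx map_block_mx !trmx0 !map_mx0. Qed.

Section NotAdmissible.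
Variable R : realType.
Local Notation A4 := (@four_cycle_algebra R).
Local Notation C4 := (cstar_generated (@jmap R @` A4)).

Lemma E4_in p q : edge4 (inord p) (inord q) -> A4 (E4 R p.+1 q.+1).
Proof.
move=> pq; apply/four_cycle_algebraP => i j ij; rewrite mxE.
case: eqP => //= ip; case: eqP => //= jq.
by rewrite ip jq pq in ij.
Qed.

Lemma delta_mul_adj (i j k : 'I_4) :
  delta_mx i j *m (delta_mx k j)^t* = delta_mx i k :> 'M[R[i]]_4.
Proof.
rewrite trmx_delta (_ : map_mx _ _ = delta_mx j k) ?mul_delta_mx//.
by apply/matrixP => p q; rewrite !mxE conjC_nat.
Qed.

Lemma schur_delta (i j : 'I_4) :
  schur_mult (pmat R) (delta_mx i j) =
  if schur_block i == schur_block j then delta_mx i j else 0.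
Proof.
apply/matrixP => p q; rewrite schurE (fun_if (fun a => fun_of_matrix a p q)) !mxE.
case: (p =P i) => [->|_]; case: (q =P j) => [->|_] //=; by do 2![case: ifP].
Qed.

Lemma ad_flip_delta (i j : 'I_4) :
  ad (dsum (flip2 R) (flip2 R)) (delta_mx i j) =
  delta_mx (swap4 i) (swap4 j).
Proof.
apply/matrixP => p q; rewrite ad_flipE !mxE.
by rewrite !(can2_eq swap4K swap4K).
Qed.

(** The contradiction appears in the second summand of
    [beta (j E_14 (j E_14)^* ) = beta (j E_11)], at position (2, 2): the left
    side has entry 0 there since [S_p E_23 = 0], the right side has entry 1. *)
Lemma jmap_not_admissible : ~ admissible A4 (@flip_action R) C4 (@jmap R).
Proof.
move=> [beta [_ betaS betaj]].
pose s : 'Z_2 := 1.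
have [_ [_ betaM] betaStar] := betaS s.
have betaJ a : A4 a ->
    beta s (jmap a) = jmap (ad (dsum (flip2 R) (flip2 R)) a).
  by move=> /(betaj s) ->.
have jC a : A4 a -> C4 (jmap a) by move=> aA; apply: sub_gen_smallest; exists a.
have [_ Cadj] := @cstar_generated_cstar R _ (@jmap R @` A4).
have A11 : A4 (E4 R 1 1) by apply: E4_in; rewrite /edge4 eqxx.
have A14 : A4 (E4 R 1 4) by apply: E4_in; rewrite /edge4 !inordK ?orbT.
have := betaM _ _ (jC _ A14) (Cadj _ (jC _ A14)).
rewrite betaStar; last exact: jC.
have -> : jmap (E4 R 1 4) *m (jmap (E4 R 1 4))^t* = jmap (E4 R 1 1).
  rewrite /jmap dsum_adj dsum_mul /E4 !schur_delta /= !eqxx.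
  have -> : schur_block (inord 3) = inord 0.
    by apply: val_inj; rewrite /schur_block -val_eqE /= !inordK.
  have -> : schur_block (inord 0) = inord 0.
    by apply: val_inj; rewrite /schur_block -val_eqE /= !inordK.
  by rewrite eqxx !delta_mul_adj.
have sw0 : swap4 (inord 0) = inord 1.
  by apply: val_inj; rewrite /= val_swap4 !inordK.
have sw3 : swap4 (inord 3) = inord 2.
  by apply: val_inj; rewrite /= val_swap4 !inordK.
rewrite !betaJ //; rewrite /jmap dsum_adj dsum_mul => /(congr1 drsubmx).
rewrite /dsum !block_mxKdr /E4 !ad_flip_delta !schur_delta sw0 sw3 eqxx.
have -> : schur_block (inord 1) == schur_block (inord 2) = false.
  by rewrite /schur_block -!val_eqE /= !inordK //= -val_eqE /= !inordK.
rewrite mul0mx => /matrixP /(_ (inord 1) (inord 1)) /eqP.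
by rewrite !mxE !eqxx oner_eq0.
Qed.
End NotAdmissible.

Theorem mainTheorem5 (R : realType) :
  let A := @four_cycle_algebra R in
  let j := @jmap R in
  let C := cstar_generated (j @` A) in
  [/\ dynamical_system A (@flip_action R),
      cstar_cover A C j
    & ~ admissible A (@flip_action R) C j].
Proof.
split; [exact: flip_dynamical_system| |exact: jmap_not_admissible].
split=> //; [exact: cstar_generated_cstar|exact: jmap_homomorphism|].
exact: jmap_completely_isometric.
Qed.
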